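(* Suppose $\nu\in\mathbb R^n$ is a real common eigenvector of the matrices $A_j$ corresponding to the eigenvalues $\lambda^j$, $j=1,\ldots,m$, respectively. Then the function $$F\colon(t,x)\to(\nu x)\exp\Bigl(-\sum_{j=1}^m\lambda^jt_j\Bigr)\quad\text{for all }(t,x)\in\mathbb R^{n+m}$$ is a first integral of the completely solvable system $dx=A(x)\,dt$.
   Context: Let $x=(x_1,\ldots,x_n)\in\mathbb R^n$, $t=(t_1,\ldots,t_m)\in\mathbb R^m$. Consider the linear autonomous system of equations in total differentials $dx=A(x)\,dt$, where $A(x)=\|a_{ij}(x)\|$ is $n\times m$ with $a_{ij}(x)=\sum_{\xi=1}^na_{ij\xi}x_\xi$, $a_{ij\xi}\in\mathbb R$. Put $\mathfrak p_j(x)=\sum_{i=1}^na_{ij}(x)\partial_{x_i}$, $j=1,\ldots,m$. The system is assumed completely solvable: $[\mathfrak p_j,\mathfrak p_\zeta]=0$ on $\mathbb R^n$ for all $j,\zeta$. Let $A_j$ be the real $n\times n$ matrix whose entry in row $i$ and column $\xi$ is $a_{\xi ji}$ (so the system is $dx=\sum_jA_j^{T}x\,dt_j$); complete solvability is equivalent to $A_jA_\zeta=A_\zeta A_j$ for all $j,\zeta$. For a vector $\nu$, $\nu x=\sum_{i=1}^n\nu_ix_i$. A continuously differentiable function $F(t,x)$ on a domain is a first integral of the system if $\partial_{t_j}F+\mathfrak p_jF=0$ there for $j=1,\ldots,m$. *)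

(* Defs.v *)
From HB Require Import structures.
From mathcomp Require Import all_boot all_order all_algebra.
From mathcomp Require Import all_classical all_reals all_analysis.

Set Implicit Arguments.
Unset Strict Implicit.
Unset Printing Implicit Defensive.

Import Order.TTheory GRing.Theory Num.Theory.
Import numFieldNormedType.Exports.

Local Open Scope classical_set_scope.
Local Open Scope ring_scope.

Definition is_domain (T : topologicalType) (D : set T) : Prop :=
  [/\ D !=set0, open D & connected D].

(* On an open D of a finite-dimensional V, continuity of every directional
   derivative is the same as continuity of the Frechet differential. *)
Fixpoint Ck_on (R : realType) (V : normedModType R) (k : nat) (D : set V)
    (f : V -> R) : Prop :=
  if k is k'.+1 then
    (forall x, D x -> differentiable f x) /\ forall v, Ck_on k' D ('D_v f)
  else forall x, D x -> {for x, continuous f}.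

Section TotalDifferentialSystem.
Context (R : realType) (n m : nat).
Implicit Types (A : 'cV[R]_n -> 'M[R]_(n, m)) (a : 'I_n -> 'I_m -> 'I_n -> R).

(* the operator p_j = \sum_i a_ij(x) d/dx_i of the system dx = A(x) dt *)
Definition pop A (j : 'I_m) (f : 'cV[R]_n -> R) : 'cV[R]_n -> R :=
  fun x => \sum_(i < n) A x i j * 'D_(delta_mx i 0) f x.

Definition pop_bracket A (j z : 'I_m) (f : 'cV[R]_n -> R) : 'cV[R]_n -> R :=
  fun x => pop A j (pop A z f) x - pop A z (pop A j f) x.

(* [p_j, p_z] = 0 as an operator; C^2 functions are those on which the second
   order compositions are defined. *)
Definition completely_solvable A : Prop :=
  forall (j z : 'I_m) (f : 'cV[R]_n -> R), Ck_on 2 setT f ->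
    forall x, pop_bracket A j z f x = 0.

Definition first_integral A (D : set ('cV[R]_m * 'cV[R]_n))
    (F : 'cV[R]_m * 'cV[R]_n -> R) : Prop :=
  [/\ is_domain D, Ck_on 1 D F &
    forall (t : 'cV[R]_m) (x : 'cV[R]_n), D (t, x) -> forall j : 'I_m,
      'D_(delta_mx j 0) (fun s => F (s, x)) t
        + pop A j (fun y => F (t, y)) x = 0].

Definition linear_system a : 'cV[R]_n -> 'M[R]_(n, m) :=
  fun x => \matrix_(i < n, j < m) \sum_(xi < n) a i j xi * x xi 0.

(* Row and column indices are swapped on purpose: the system reads
   dx = \sum_j (coef_mx a j)^T x dt_j. *)
Definition coef_mx a (j : 'I_m) : 'M[R]_n :=
  \matrix_(i < n, xi < n) a xi j i.

End TotalDifferentialSystem.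

(* Main.v *)
Require Import Defs.
From HB Require Import structures.
From mathcomp Require Import all_boot all_order all_algebra.
From mathcomp Require Import all_classical all_reals all_analysis.
Set Implicit Arguments.
Unset Strict Implicit.
Unset Printing Implicit Defensive.
Import Order.TTheory GRing.Theory Num.Theory.
Import numFieldNormedType.Exports.
Local Open Scope classical_set_scope.
Local Open Scope ring_scope.

(** Along a solution of [dx = A(x) dt] the linear form [nu x] satisfies
    [d(nu x) = \sum_j lambda^j (nu x) dt_j], because
    [p_j (nu x) = (A_j nu) x = lambda^j (nu x)] when [nu] is a common
    eigenvector ([linear_system_eigenform]).  The factor
    [exp (- \sum_j lambda^j t_j)] decays at exactly the opposite rate in each
    [t_j], so the two contributions to the total derivative of the product
    cancel.

    Both the form and the exponent are continuous linear forms on the product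
    space of pairs [(t, x)], so every derivative involved is a case of a single
    formula, for the directional derivatives of [f * exp g] with [f] and [g]
    continuous and linear ([is_derive_linear_expR]); since that formula is again
    built from [f] and [exp g], it also shows that [f * exp g] is of class C^1
    ([Ck1_linear_expR]).  The partial derivatives in [t_j] and in [x_i] are the
    directional derivatives along the vectors [(e_j, 0)] and [(0, e_i)]
    ([derive_pairl] and [derive_pairr]). *)

(** A normed space is the union of its lines through the origin, each of them a
    continuous image of the real line. *)
Lemma connected_normed_setT (R : realType) (V : normedModType R) :
  connected [set: V].
Proof.
have -> : [set: V] = \bigcup_(v in [set: V]) range (fun h : R => h *: v).
  rewrite eqEsubset; split=> // v _; exists v => //.
  by exists 1 => //; rewrite scale1r.
apply: bigcup_connected => [|v _].
  by exists 0 => v _; exists 0 => //; rewrite scale0r.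
apply: connected_continuous_connected.
  by apply/connected_intervalP => x y _ _ z _.
by apply: continuous_subspaceT => h; exact: scalel_continuous.
Qed.

Section PartialDerivatives.
Context (R : realType) (U V W : normedModType R) (F : U * V -> W).

Lemma derive_pairl (u du : U) (v : V) :
  'D_du (fun s => F (s, v)) u = 'D_((du, 0) : U * V) F (u, v).
Proof.
rewrite /derive; apply: (congr1 (fun G : R -> W => lim (G @ 0^'))).
apply/funext => h /=.
have -> : h *: ((du, 0) : U * V) + (u, v) = (h *: du + u, v) => //.
by congr pair; rewrite /= scaler0 add0r.
Qed.

Lemma derive_pairr (u : U) (v dv : V) :
  'D_dv (fun y => F (u, y)) v = 'D_((0, dv) : U * V) F (u, v).
Proof.
rewrite /derive; apply: (congr1 (fun G : R -> W => lim (G @ 0^'))).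
apply/funext => h /=.
have -> : h *: ((0, dv) : U * V) + (u, v) = (u, h *: dv + v) => //.
by congr pair; rewrite /= scaler0 add0r.
Qed.

End PartialDerivatives.

Section LinearTimesExponential.
Context (R : realType) (V : normedModType R) (f g : {linear V -> R}).
Hypotheses (f_cont : continuous f) (g_cont : continuous g).

Let F (x : V) : R := f x * expR (g x).

Lemma is_derive_linear (h : {linear V -> R}) (x v : V) :
  continuous h -> is_derive x v h (h v).
Proof.
move=> h_cont; have hd := linear_differentiable x h_cont.
by split; [exact: diff_derivable | rewrite deriveE // diff_lin].
Qed.

Lemma differentiable_expR_linear (x : V) :
  differentiable (fun y => expR (g y)) x.
Proof.
apply: differentiable_comp; first exact: linear_differentiable.
exact/derivable1_diffP/derivable_expR.
Qed.

Lemma differentiable_linear_expR (x : V) : differentiable F x.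
Proof.
apply: differentiableM; first exact: linear_differentiable.
exact: differentiable_expR_linear.
Qed.

Lemma is_derive_linear_expR (x v : V) :
  is_derive x v F ((f v + f x * g v) * expR (g x)).
Proof.
have gd := linear_differentiable x g_cont.
have ed : differentiable expR (g x).
  exact/derivable1_diffP/derivable_expR.
have de : is_derive x v (fun y => expR (g y)) (g v * expR (g x)).
  split; first exact/diff_derivable/differentiable_expR_linear.
  rewrite deriveE; last exact: differentiable_expR_linear.
  rewrite (diff_comp gd ed) /= diff_lin // diff1E // derive1E.
  by have [_ ->] := is_derive_expR (g x).
have df := is_derive_linear x v f_cont.
apply: is_derive_eq.
by rewrite /GRing.scale /=; rewrite mulrDl addrC mulrA [f v * _]mulrC.
Qed.

Lemma Ck1_linear_expR (D : set V) : Ck_on 1 D F.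
Proof.
split=> [x _|v x _]; first exact: differentiable_linear_expR.
have -> : 'D_v F = fun y => (f v + f y * g v) * expR (g y).
  by apply/funext => y; have [_ ->] := is_derive_linear_expR y v.
apply: continuousM; last first.
  exact/differentiable_continuous/differentiable_expR_linear.
apply: continuousD; first exact: cst_continuous.
by apply: continuousM; [exact: f_cont | exact: cst_continuous].
Qed.

End LinearTimesExponential.

Section CoordinateForms.
Context (R : realType) (n : nat).

Definition coord_form (c : 'I_n -> R) (x : 'cV[R]_n) : R :=
  \sum_(i < n) c i * x i 0.

Lemma coord_form_is_linear c : linear (coord_form c).
Proof.
move=> k x y; rewrite /coord_form scaler_sumr -big_split /=.
by apply: eq_bigr => i _; rewrite !mxE mulrDr mulrCA.
Qed.

HB.instance Definition _ c := GRing.isLinear.Build R 'cV[R]_n R _ (coord_form c)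
  (coord_form_is_linear c).

Lemma coord_form_continuous c : continuous (coord_form c).
Proof.
rewrite /coord_form; apply: continuous_big => [|i _ x].
  exact: add_continuous.
by apply: continuousM; [exact: cst_continuous | exact: coord_continuous].
Qed.

Lemma coord_form_delta c i : coord_form c (delta_mx i 0) = c i.
Proof.
rewrite /coord_form (bigD1 i) //= mxE !eqxx mulr1 big1 ?addr0 // => k ki.
by rewrite mxE (negbTE ki) mulr0.
Qed.

End CoordinateForms.

(** The left-hand side is [p_j (nu x)]: exchanging the two summations turns it
    into [(A_j nu) x]. *)
Lemma linear_system_eigenform (R : realType) (n m : nat)
    (a : 'I_n -> 'I_m -> 'I_n -> R) (nu : 'cV[R]_n) (l : R) (j : 'I_m)
    (x : 'cV[R]_n) :
  coef_mx a j *m nu = l *: nu ->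
  \sum_(i < n) linear_system a x i j * nu i 0
    = l * \sum_(i < n) nu i 0 * x i 0.
Proof.
move=> nu_eigen.
under eq_bigr => i _ do rewrite mxE mulr_suml.
rewrite exchange_big mulr_sumr; apply: eq_bigr => k _ /=.
have /matrixP/(_ k 0) := nu_eigen; rewrite !mxE mulrA => <-.
by rewrite mulr_suml; apply: eq_bigr => i _; rewrite !mxE mulrAC.
Qed.

Theorem theorem2p5 (R : realType) (n m : nat)
    (a : 'I_n -> 'I_m -> 'I_n -> R) (nu : 'cV[R]_n) (lambda : 'I_m -> R)
    (a_solvable : completely_solvable (linear_system a))
    (nu_neq0 : nu != 0)
    (nu_eigen : forall j : 'I_m, coef_mx a j *m nu = lambda j *: nu) :
  first_integral (linear_system a) setT
    (fun p : 'cV[R]_m * 'cV[R]_n =>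
       (\sum_(i < n) nu i 0 * p.2 i 0)
         * expR (- \sum_(j < m) lambda j * p.1 j 0)).
Proof.
pose V : normedModType R := ('cV[R]_m * 'cV[R]_n)%type.
pose f : {linear V -> R} := coord_form (fun i => nu i 0) \o snd.
pose g : {linear V -> R} := \- (coord_form lambda \o fst).
have f_cont : continuous f.
  move=> p; apply: continuous_comp; first exact: cvg_snd.
  exact: coord_form_continuous.
have g_cont : continuous g.
  move=> p; apply: continuousN; apply: continuous_comp; first exact: cvg_fst.
  exact: coord_form_continuous.
split.
- split; [by exists 0 | exact: openT | exact: connected_normed_setT].
- exact: (Ck1_linear_expR f_cont g_cont).
- move=> t x _ j; pose F (p : V) : R := f p * expR (g p).
  change ('D_(delta_mx j 0) (fun s => F (s, x)) t
    + pop (linear_system a) j (fun y => F (t, y)) x = 0).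
  have DF (v : V) : 'D_v F (t, x) = (f v + f (t, x) * g v) * expR (g (t, x)).
    by have [_] := is_derive_linear_expR f_cont g_cont (t, x) v.
  rewrite (derive_pairl F) DF /pop.
  under eq_bigr => i _ do rewrite (derive_pairr F) DF.
  rewrite /f /g /= !linear0 coord_form_delta.
  under eq_bigr => i _ do rewrite coord_form_delta mulr0 addr0 mulrA.
  rewrite -mulr_suml (linear_system_eigenform x (nu_eigen j)) -mulrDl.
  by rewrite add0r mulrN [lambda j * _]mulrC addNr mul0r.
Qed.
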